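(* For any two m-saturated dependence epistemic models $\mathcal{M}$ and $\mathcal{M}'$ and any $s\in S$, $s'\in S'$: there is a bisimulation $B$ between $\mathcal{M}$ and $\mathcal{M}'$ with $sBs'$ if and only if $\mathcal{M},s$ and $\mathcal{M}',s'$ satisfy exactly the same $\textbf{EDL}$-formulas.
   Context: Fix countable sets $\mathbb{P}$ (propositions) and $\mathbb{V}$ (variables). $\textbf{EDL}$ formulas: $\phi::=\top\mid p\mid\neg\phi\mid(\phi\land\phi)\mid\mathcal{K}\phi\mid\mathcal{A}\phi\mid\mathcal{D}_g(X,Y)\mid\mathcal{D}_l(X,Y)$ with $p\in\mathbb{P}$ and $X,Y$ finite subsets of $\mathbb{V}$. A dependence epistemic model is $\mathcal{M}=\langle S,T,V,U,\sim_i,\approx\rangle$: $S$ a set of worlds, $T:S\times\mathbb{P}\to\{0,1\}$, $V\supseteq\mathbb{V}$ a countable set of variables, $U:S\times V\to\mathbb{N}$, $\sim_i,\approx$ equivalence relations on $S$. For $X\subseteq V$, $X_s=X_t$ iff $U(s,x)=U(t,x)$ for all $x\in X$, else $X_s\neq X_t$. Semantics: $\top$ always true; $s\vDash p$ iff $T(s,p)=1$; Boolean clauses as usual; $s\vDash\mathcal{K}\phi$ iff $t\vDash\phi$ for all $t\sim_i s$; $s\vDash\mathcal{A}\phi$ iff $t\vDash\phi$ for all $t\approx s$; $s\vDash\mathcal{D}_g(X,Y)$ iff there exist $u\approx v\approx s$ with $(V\setminus(X\cup Y))_u=(V\setminus(X\cup Y))_v$, $X_u\neq X_v$, $Y_u\neq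 Y_v$; $s\vDash\mathcal{D}_l(X,Y)$ iff there exists $t\approx s$ with $(V\setminus(X\cup Y))_t=(V\setminus(X\cup Y))_s$, $X_t\neq X_s$, $Y_t\neq Y_s$. For $u,v\in S$, $\Delta(u,v)=\{x\in\mathbb{V}\mid U(u,x)\neq U(v,x)\}$ if $(V\setminus\mathbb{V})_u=(V\setminus\mathbb{V})_v$, else $\emptyset$. $W$ is an evidence of $\langle X,Y\rangle$ iff $W\cap X\neq\emptyset$, $W\cap Y\neq\emptyset$, $W\subseteq X\cup Y$. $\mathcal{P}_g(s)=\{\Delta(u,v)\mid u\approx v\approx s,\ \Delta(u,v)\text{ nonempty finite}\}$, $\mathcal{P}_l(s)=\{\Delta(t,s)\mid t\approx s,\ \Delta(t,s)\text{ nonempty finite}\}$. A nonempty finite $W\subseteq\mathbb{V}$ is generative from $\mathcal{P}(s)$ iff for all finite $X,Y\subseteq\mathbb{V}$ such that $W$ is an evidence of $\langle X,Y\rangle$ some $W'\in\mathcal{P}(s)$ is an evidence of $\langle X,Y\rangle$; $\mathfrak{G}_g(s)$, $\mathfrak{G}_l(s)$ are the sets of nonempty finite $W\subseteq\mathbb{V}$ generative from $\mathcal{P}_g(s)$, $\mathcal{P}_l(s)$ respectively. A nonempty relation $B\subseteq S\times S'$ is a bisimulation iff whenever $sBs'$: $T(s,p)=T'(s',p)$ for all $p\in\mathbb{P}$; $\mathfrak{G}_g(s)=\mathfrak{G}_g(s')$; $\mathfrak{G}_l(s)=\mathfrak{G}_l(s')$; for each of the relations $R\in\{\sim_i,\approx\}$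 (with counterpart $R'$ in $\mathcal{M}'$): if $sRt$ then there is $t'$ with $s'R't'$ and $tBt'$, and if $s'R't'$ then there is $t$ with $sRt$ and $tBt'$. A model is m-saturated (in the sense of Blackburn–de Rijke–Venema, Def. 2.53) iff for each world $s$, each relation $R\in\{\sim_i,\approx\}$ and each set $\Sigma$ of $\textbf{EDL}$-formulas: if every finite subset of $\Sigma$ is satisfied at some $R$-successor of $s$, then $\Sigma$ is satisfied at some $R$-successor of $s$. *)

(* Defs.v *)
From HB Require Import structures.
From mathcomp Require Import all_boot finmap.
From mathcomp Require Import boolp classical_sets functions cardinality.
From Stdlib Require Import RelationClasses.

Set Implicit Arguments.
Unset Strict Implicit.
Unset Printing Implicit Defensive.

Local Open Scope classical_set_scope.

Inductive form (Prp Var : countType) : Type :=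
| FTop
| FProp of Prp
| FNeg of form Prp Var
| FAnd of form Prp Var & form Prp Var
| FK of form Prp Var
| FA of form Prp Var
| FDg of {fset Var} & {fset Var}
| FDl of {fset Var} & {fset Var}.

(* The inclusion of Var in the variables vars of a model is rendered by an
   injection incl, so that models may have different additional variables. *)
Record model (Prp Var : countType) := Model {
  world : Type;
  truth : world -> Prp -> bool;
  vars : countType;
  incl : Var -> vars;
  incl_inj : injective incl;
  value : world -> vars -> nat;
  sim : world -> world -> Prop;
  sim_equiv : Equivalence sim;
  approx : world -> world -> Prop;
  approx_equiv : Equivalence approx
}.

(* agree X s t stands for X_s = X_t. *)
Definition agree (Prp Var : countType) (M : model Prp Var)
    (X : set (vars M)) (s t : world M) : Prop :=
  forall x, X x -> value s x = value t x.

Definition varset (Prp Var : countType) (M : model Prp Var) (X : {fset Var}) :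
    set (vars M) :=
  @incl _ _ M @` [set` X].

Arguments varset {Prp Var} M X.

Fixpoint sat (Prp Var : countType) (M : model Prp Var) (s : world M)
    (phi : form Prp Var) {struct phi} : Prop :=
  match phi with
  | FTop => True
  | FProp p => truth s p = true
  | FNeg f => ~ sat s f
  | FAnd f g => sat s f /\ sat s g
  | FK f => forall t, sim t s -> sat t f
  | FA f => forall t, approx t s -> sat t f
  | FDg X Y => exists u v, [/\ approx u v /\ approx v s,
      agree (~` (varset M X `|` varset M Y)) u v,
      ~ agree (varset M X) u v & ~ agree (varset M Y) u v]
  | FDl X Y => exists t, [/\ approx t s,
      agree (~` (varset M X `|` varset M Y)) t s,
      ~ agree (varset M X) t s & ~ agree (varset M Y) t s]
  end.

Definition Delta (Prp Var : countType) (M : model Prp Var) (u v : world M) :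
    set Var :=
  if `[< agree (~` range (@incl _ _ M)) u v >]
  then [set x | value u (incl M x) <> value v (incl M x)]
  else set0.

Definition evidence (Var : countType) (W : set Var) (X Y : {fset Var}) : Prop :=
  [/\ W `&` [set` X] !=set0, W `&` [set` Y] !=set0
    & W `<=` [set` X] `|` [set` Y]].

Definition Pg (Prp Var : countType) (M : model Prp Var) (s : world M) :
    set (set Var) :=
  [set W | exists u v, [/\ approx u v /\ approx v s, W = Delta u v,
                           W !=set0 & finite_set W]].

Definition Pl (Prp Var : countType) (M : model Prp Var) (s : world M) :
    set (set Var) :=
  [set W | exists t, [/\ approx t s, W = Delta t s,
                         W !=set0 & finite_set W]].

Definition generated (Var : countType) (P : set (set Var)) : set (set Var) :=
  [set W | [/\ W !=set0, finite_set W
     & forall X Y : {fset Var}, evidence W X Y ->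
         exists2 W', P W' & evidence W' X Y]].

Definition Gg (Prp Var : countType) (M : model Prp Var) (s : world M) :=
  generated (Pg s).

Definition Gl (Prp Var : countType) (M : model Prp Var) (s : world M) :=
  generated (Pl s).

Definition back_and_forth (S S' : Type) (R : S -> S -> Prop)
    (R' : S' -> S' -> Prop) (B : S -> S' -> Prop) (s : S) (s' : S') : Prop :=
  (forall t, R s t -> exists2 t', R' s' t' & B t t') /\
  (forall t', R' s' t' -> exists2 t, R s t & B t t').

Definition bisimulation (Prp Var : countType) (M M' : model Prp Var)
    (B : world M -> world M' -> Prop) : Prop :=
  (exists s s', B s s') /\
  forall s s', B s s' ->
    [/\ forall p, truth s p = truth s' p,
        Gg s = Gg s',
        Gl s = Gl s',
        back_and_forth (@sim _ _ M) (@sim _ _ M') B s s'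
      & back_and_forth (@approx _ _ M) (@approx _ _ M') B s s'].

Definition sat_set (Prp Var : countType) (M : model Prp Var) (s : world M)
    (Sigma : set (form Prp Var)) : Prop :=
  forall phi, Sigma phi -> sat s phi.

Definition saturated_for (Prp Var : countType) (M : model Prp Var)
    (R : world M -> world M -> Prop) : Prop :=
  forall (s : world M) (Sigma : set (form Prp Var)),
    (forall F : set (form Prp Var), F `<=` Sigma -> finite_set F ->
       exists2 t, R s t & sat_set t F) ->
    exists2 t, R s t & sat_set t Sigma.

Definition m_saturated (Prp Var : countType) (M : model Prp Var) : Prop :=
  saturated_for (@sim _ _ M) /\ saturated_for (@approx _ _ M).

(* Main.v *)
(** [FDg X Y] (resp. [FDl X Y]) holds at [s] iff some element of [Pg s] (resp.
    [Pl s]) is an evidence of [(X, Y)]; the generated family [Gg s] (resp.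
    [Gl s]) determines, and is determined by, the pairs having such an
    evidence.  Hence agreement on [Gg] and [Gl] is agreement on the dependence
    atoms, and the equivalence is an instance of the Hennessy-Milner
    argument. *)

Require Import Defs.
From mathcomp Require Import all_boot.
From mathcomp Require Import finmap boolp classical_sets functions cardinality.
From Stdlib Require Import RelationClasses.

Set Implicit Arguments.
Unset Strict Implicit.
Unset Printing Implicit Defensive.

Local Open Scope classical_set_scope.

Lemma not_agreeP (Prp Var : countType) (M : model Prp Var) (X : set (vars M))
    (u v : world M) :
  ~ agree X u v <-> exists2 x, X x & value u x <> value v x.
Proof.
split=> [nA|[x Xx nx] A]; last exact/nx/A.
apply: contrapT => nE; apply: nA => x Xx.
by apply: contrapT => nx; apply: nE; exists x.
Qed.

(** Agreement off [X] and [Y] splits along the range of [incl]: outside the range it is the test in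
    [Delta], inside it is the inclusion of [Delta u v] in the union of [X] and [Y]. Injectivity of
    [incl] lets differing variables be read back in [Var]. *)
Lemma evidence_DeltaP (Prp Var : countType) (M : model Prp Var)
    (X Y : {fset Var}) (u v : world M) :
  evidence (Delta u v) X Y <->
  [/\ agree (~` (varset M X `|` varset M Y)) u v,
      ~ agree (varset M X) u v & ~ agree (varset M Y) u v].
Proof.
split.
(* When the test fails, [Delta u v] is empty and so meets neither [X] nor [Y]. *)
- rewrite /Delta; case: asboolP => [Aout|_]; last by case=> -[? []].
  case=> -[x [nx Xx]] [y [ny Yy]] sub; split.
  + move=> z nz; apply: contrapT => dz.
    have [[w _ wz]|nr] := pselect (range (@Defs.incl _ _ M) z); last exact/dz/Aout.
    rewrite -wz in dz nz; apply: nz.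
    by have [wX|wY] := sub w dz; [left|right]; exists w.
  + by apply/not_agreeP; exists (Defs.incl M x) => //; exists x.
  + by apply/not_agreeP; exists (Defs.incl M y) => //; exists y.
- case=> Aout /not_agreeP[_ [x Xx <-] nx] /not_agreeP[_ [y Yy <-] ny].
  rewrite /Delta; case: asboolP => [_|[]]; last first.
    move=> z nz; apply: Aout => -[] [w _ wz]; apply: nz; exists w => //.
  split; [by exists x|by exists y|].
  move=> z /= nz; apply: contrapT => nXY.
  apply/nz/Aout => -[] [w wXY /incl_inj wz]; apply: nXY; rewrite -wz.
  - by left.
  - by right.
Qed.

Lemma evidence_nonempty (Var : countType) (W : set Var) (X Y : {fset Var}) :
  evidence W X Y -> W !=set0.
Proof. by case=> -[x [Wx _]] _ _; exists x. Qed.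

Lemma evidence_finite (Var : countType) (W : set Var) (X Y : {fset Var}) :
  evidence W X Y -> finite_set W.
Proof.
case=> _ _ /sub_finite_set; apply.
by rewrite finite_setU; split; exact: finite_fset.
Qed.

(** Generativity says exactly that a set serves no pair that [P] does not already serve. Conversely,
    a member of [P] that is an evidence lies in a finite union and meets [X], so it is finite,
    nonempty and its own witness. *)
Lemma generated_evidenceP (Var : countType) (P : set (set Var))
    (X Y : {fset Var}) :
  (exists2 W, generated P W & evidence W X Y) <->
  (exists2 W, P W & evidence W X Y).
Proof.
split=> [[W [_ _ gW] /gW //]|[W PW eW]]; exists W => //.
split; [exact: evidence_nonempty eW|exact: evidence_finite eW|].
by move=> X' Y' e'; exists W.
Qed.

Lemma eq_generated (Var : countType) (P P' : set (set Var)) :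
  (forall X Y : {fset Var}, (exists2 W, P W & evidence W X Y) <->
                            (exists2 W, P' W & evidence W X Y)) ->
  generated P = generated P'.
Proof.
move=> PP'; apply/seteqP; split=> W [W0 Wf gW]; split=> // X Y /gW.
- by move/PP'.
- by move=> /PP'.
Qed.

Lemma sat_DgP (Prp Var : countType) (M : model Prp Var) (s : world M)
    (X Y : {fset Var}) :
  sat s (FDg Prp X Y) <-> exists2 W, Pg s W & evidence W X Y.
Proof.
split=> [[u [v [uvs A B C]]]|[_ [u [v [uvs -> _ _]]] /evidence_DeltaP[]]].
- have e : evidence (Delta u v) X Y by apply/evidence_DeltaP.
  exists (Delta u v) => //; exists u, v.
  by split=> //; [exact: evidence_nonempty e|exact: evidence_finite e].
- by exists u, v.
Qed.

Lemma sat_DlP (Prp Var : countType) (M : model Prp Var) (s : world M)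
    (X Y : {fset Var}) :
  sat s (FDl Prp X Y) <-> exists2 W, Pl s W & evidence W X Y.
Proof.
split=> [[t [ts A B C]]|[_ [t [ts -> _ _]] /evidence_DeltaP[]]].
- have e : evidence (Delta t s) X Y by apply/evidence_DeltaP.
  exists (Delta t s) => //; exists t.
  by split=> //; [exact: evidence_nonempty e|exact: evidence_finite e].
- by exists t.
Qed.

Definition form_equiv (Prp Var : countType) (M M' : model Prp Var)
    (s : world M) (s' : world M') : Prop :=
  forall phi, sat s phi <-> sat s' phi.

Lemma form_equiv_sym (Prp Var : countType) (M M' : model Prp Var)
    (s : world M) (s' : world M') : form_equiv s s' -> form_equiv s' s.
Proof. by move=> e phi; split=> /e. Qed.

(** Serves both modalities. Symmetry is needed because [sat] quantifies over [R t s] while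
    [back_and_forth] follows [R s t]. *)
Lemma box_invariant (S S' : Type) (R : S -> S -> Prop) (R' : S' -> S' -> Prop)
    (B : S -> S' -> Prop) (s : S) (s' : S') (P : S -> Prop) (P' : S' -> Prop) :
  Equivalence R -> Equivalence R' -> back_and_forth R R' B s s' ->
  (forall t t', B t t' -> P t <-> P' t') ->
  (forall t, R t s -> P t) <-> (forall t', R' t' s' -> P' t').
Proof.
move=> [_ symR _] [_ symR' _] [forth back] PP'; split=> H t ts.
- by have [u su ut] := back _ (symR' _ _ ts); apply/(PP' _ _ ut)/H/symR.
- by have [u su ut] := forth _ (symR _ _ ts); apply/(PP' _ _ ut)/H/symR'.
Qed.

Lemma bisimulation_form_equiv (Prp Var : countType) (M M' : model Prp Var)
    (B : world M -> world M' -> Prop) (s : world M) (s' : world M') :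
  bisimulation B -> B s s' -> form_equiv s s'.
Proof.
case=> _ bisB + phi; elim: phi s s' => [|p|f IH|f IHf g IHg|f IH|f IH|X Y|X Y]
  s s' ss'; have [Eprp Eg El bfsim bfapprox] := bisB _ _ ss'.
- by [].
- by rewrite /= Eprp.
- by have := IH _ _ ss' => /= ?; tauto.
- by have := IHf _ _ ss'; have := IHg _ _ ss' => /= ? ?; tauto.
- exact: box_invariant (sim_equiv M) (sim_equiv M') bfsim IH.
- exact: box_invariant (approx_equiv M) (approx_equiv M') bfapprox IH.
(* Go up from [Pg s] to [Gg s], cross to [Gg s'], and come down to [Pg s']. *)
- by rewrite !sat_DgP -(generated_evidenceP (Pg s)) -/(Gg s) Eg generated_evidenceP.
- by rewrite !sat_DlP -(generated_evidenceP (Pl s)) -/(Gl s) El generated_evidenceP.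
Qed.

(** The formula is chosen before the model, so that it can be evaluated in both models being
    compared. *)
Lemma finite_conj (Prp Var : countType) (F : set (form Prp Var)) :
  finite_set F ->
  exists phi, forall (M : model Prp Var) (s : world M),
    sat s phi <-> sat_set s F.
Proof.
move=> /(@finite_seqP {classic form Prp Var})[fs ->].
elim: fs => [|f fs [phi phiP]].
  by exists (FTop _ _) => M s; split.
exists (FAnd f phi) => M s /=; rewrite phiP; split.
- move=> [sf sfs] g /=; rewrite inE => /orP[/eqP -> //|gfs]; exact: sfs.
- move=> sfs; split; first by apply: sfs; rewrite /= mem_head.
  by move=> g gfs; apply: sfs; rewrite /= inE gfs orbT.
Qed.

(* The theory of [t] is finitely satisfiable at [R']-successors of [s'], hence by
   saturation satisfied at one of them. *)
Lemma saturated_forth (Prp Var : countType) (M M' : model Prp Var)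
    (R : world M -> world M -> Prop) (R' : world M' -> world M' -> Prop)
    (box : form Prp Var -> form Prp Var) (s t : world M) (s' : world M') :
  Equivalence R -> Equivalence R' ->
  (forall f, sat s (box f) = forall u, R u s -> sat u f) ->
  (forall f, sat s' (box f) = forall u, R' u s' -> sat u f) ->
  saturated_for R' -> form_equiv s s' -> R s t ->
  exists2 t', R' s' t' & form_equiv t t'.
Proof.
move=> [_ symR _] [_ symR' _] boxE boxE' satR' ss' st.
have [F Ft Ffin|t' st' tt'] := satR' s' [set f | sat t f].
  have [phi phiP] := finite_conj Ffin.
  apply: contrapT => nE.
  (* If no successor of [s'] satisfied [F], this boxed negation would transfer to [s] and contradict
     that [t] satisfies [F]. *)
  have : sat s' (box (FNeg phi)).
    by rewrite boxE' => u us /= /phiP uF; apply: nE; exists u => //; exact: symR'.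
  by move=> /ss'; rewrite boxE => /(_ t (symR _ _ st)) /=; apply; apply/phiP.
(* A theory is closed under negating what fails, so inclusion of the theory of [t] in that of [t']
   already gives equality. *)
exists t' => // phi; split=> [/tt' //|pt']; apply: contrapT => npt.
exact: (tt' (FNeg phi) npt).
Qed.

Lemma form_equiv_bisimulation (Prp Var : countType) (M M' : model Prp Var)
    (s : world M) (s' : world M') :
  m_saturated M -> m_saturated M' -> form_equiv s s' ->
  bisimulation (@form_equiv Prp Var M M').
Proof.
move=> [simM approxM] [simM' approxM'] ss'; split; first by exists s, s'.
move=> {}s {}s' {}ss'; have s's := form_equiv_sym ss'; split.
- by move=> p; have := ss' (FProp _ p) => /= -[pp' p'p]; apply/idP/idP.
- by apply: eq_generated => X Y; rewrite -!sat_DgP.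
- by apply: eq_generated => X Y; rewrite -!sat_DlP.
- split=> t st.
  + exact: (saturated_forth (box := @FK Prp Var) (sim_equiv M) (sim_equiv M')
      _ _ simM' ss' st).
  (* The back clause is the forth clause with the two models exchanged. *)
  + have [//|//|u su /form_equiv_sym tu] := saturated_forth
      (box := @FK Prp Var) (sim_equiv M') (sim_equiv M) _ _ simM s's st.
    by exists u.
- split=> t st.
  + exact: (saturated_forth (box := @FA Prp Var) (approx_equiv M)
      (approx_equiv M') _ _ approxM' ss' st).
  + have [//|//|u su /form_equiv_sym tu] := saturated_forth
      (box := @FA Prp Var) (approx_equiv M') (approx_equiv M) _ _ approxM s's st.
    by exists u.
Qed.

Theorem mainTheorem7 (Prp Var : countType) (M M' : model Prp Var)
    (hM : m_saturated M) (hM' : m_saturated M')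
    (s : world M) (s' : world M') :
  (exists B : world M -> world M' -> Prop, bisimulation B /\ B s s') <->
  (forall phi : form Prp Var, sat s phi <-> sat s' phi).
Proof.
split=> [[B [bisB ss']]|ss']; first exact: bisimulation_form_equiv bisB ss'.
exists (@form_equiv Prp Var M M'); split=> //.
exact: form_equiv_bisimulation hM hM' ss'.
Qed.
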